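(* Let $\mathbf X=(X_1,\dots,X_p)$ be a random vector of real features and $Y\in\{1,\dots,K\}$ a class label, with $(\mathbf X_i,Y_i)$, $i=1,\dots,n$, i.i.d. copies of $(\mathbf X,Y)$, and let $w_{j,l}$, $\hat w_{j,l}$ and $\mathbf S$ be as defined in the context. Assume: (C1) there exist positive constants $c_1,c_2$ with $c_1/K\le\min_k\pi_k\le\max_k\pi_k\le c_2/K$; (C2) there exist constants $c>0$ and $0\le r<1/2$ with $\min_{(j,l)\in\mathbf S}w_{j,l}>2cn^{-r}$; (C3) $K=O(n^d)$ for some $0\le d<\tfrac12-r$; (C4) $\log(p)=o(n^{1-2(r+d)})$; (C5) $\liminf_{p\to\infty}\{\min_{(j,l)\in\mathbf S}w_{j,l}-\max_{(j,l)\in\mathbf S^c}w_{j,l}\}\ge c_3$ for some constant $c_3>0$; and assume moreover $K^2\log(n)/n=o(1)$. Then $$\liminf_{n\to\infty}\Big\{\min_{(j,l)\in\mathbf S}\hat w_{j,l}-\max_{(j,l)\in\mathbf S^c}\hat w_{j,l}\Big\}>0\quad\text{almost surely.}$$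
   Context: Let $(\tilde{\mathbf X},\tilde Y)$ be an independent copy of $(\mathbf X,Y)$. Kendall's $\tau$: $\tau(X_j,X_l)=2\mathbb{P}((X_j-\tilde X_j)(X_l-\tilde X_l)>0)-1$; conditional Kendall's $\tau$: $\tau_k(X_j,X_l)=2\mathbb{P}((X_j-\tilde X_j)(X_l-\tilde X_l)>0\mid Y=k,\tilde Y=k)-1$; $\pi_k=\mathbb{P}(Y=k)$. KIF score: $w_{j,l}=\sum_{k=1}^K\pi_k|\tau_k(X_j,X_l)-\tau(X_j,X_l)|$. Empirical versions: $n_k=\sum_i\mathbf 1\{Y_i=k\}$, $\hat\pi_k=n_k/n$, $\hat\tau(X_j,X_l)=\frac{4}{n(n-1)}\sum_{1\le i<t\le n}\mathbf 1\{(X_{ij}-X_{tj})(X_{il}-X_{tl})>0\}-1$, $\hat\tau_k(X_j,X_l)=\frac{4}{n_k(n_k-1)}\sum_{1\le i<t\le n}\mathbf 1\{(X_{ij}-X_{tj})(X_{il}-X_{tl})>0,Y_i=k,Y_t=k\}-1$, and $\hat w_{j,l}=\sum_{k=1}^K\hat\pi_k|\hat\tau_k(X_j,X_l)-\hat\tau(X_j,X_l)|$. $\mathbf S\subseteq\{1,\dots,p\}^2$ is the set of relevant couples (pairs $(j,l)$ such that $F(Y\mid\mathbf X)$ functionally depends on the rank association of $(X_j,X_l)$), $\mathbf S^c$ its complement. Asymptotics are as $n\to\infty$, with $p$ and $K$ allowed to depend on $n$. *)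

(* Defs.v *)
From HB Require Import structures.
From mathcomp Require Import all_boot all_order all_algebra.
From mathcomp Require Import all_classical all_reals all_analysis.
Set Implicit Arguments.
Unset Strict Implicit.
Unset Printing Implicit Defensive.
Import Order.TTheory GRing.Theory Num.Theory.
Import numFieldNormedType.Exports.
Local Open Scope classical_set_scope.
Local Open Scope ring_scope.

Section KIF.
Context (R : realType) (dT : measure_display) (T : measurableType dT)
        (P : probability T R).

Definition Pr (A : set T) : R := fine (P A).

Definition cdf_event (p K : nat) (X : 'I_p -> T -> R) (Y : T -> 'I_K)
  (a : 'I_p -> R) (k : 'I_K) : set T :=
  [set w | (forall j, X j w <= a j) /\ Y w = k].

(* (X_i, Y_i), i = 0, ..., n-1, are i.i.d. random elements of R^p x {classes}:
   measurable, mutually independent and identically distributed, where the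
   (joint) law of (X_i, Y_i) is characterised by its distribution function
   (a, k) |-> P(X_i <= a, Y_i = k). *)
Definition sample_iid (n p K : nat) (X : nat -> 'I_p -> T -> R)
  (Y : nat -> T -> 'I_K) : Prop :=
  [/\ (forall i j, (i < n)%N -> measurable_fun setT (X i j)),
      (forall i k, (i < n)%N -> measurable (Y i @^-1` [set k])),
      (forall (J : seq nat), uniq J -> all (fun i => (i < n)%N) J ->
         forall (a : nat -> 'I_p -> R) (k : nat -> 'I_K),
         P [set w | forall i, i \in J -> cdf_event (X i) (Y i) (a i) (k i) w]
         = (\prod_(i <- J) P (cdf_event (X i) (Y i) (a i) (k i)))%E)
    & (forall i, (i < n)%N -> forall a k,
         P (cdf_event (X i) (Y i) a k) = P (cdf_event (X 0%N) (Y 0%N) a k))].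

(* population quantities, computed from a pair (X,Y) and an independent
   copy (Xt,Yt) *)
Definition pi_pop (K : nat) (Y : T -> 'I_K) (k : 'I_K) : R :=
  Pr (Y @^-1` [set k]).

Definition tau_pop (p : nat) (X Xt : 'I_p -> T -> R) (j l : 'I_p) : R :=
  2 * Pr [set w | 0 < (X j w - Xt j w) * (X l w - Xt l w)] - 1.

Definition tauk_pop (p K : nat) (X Xt : 'I_p -> T -> R) (Y Yt : T -> 'I_K)
  (k : 'I_K) (j l : 'I_p) : R :=
  2 * (Pr [set w | 0 < (X j w - Xt j w) * (X l w - Xt l w) /\ Y w = k /\ Yt w = k]
       / Pr [set w | Y w = k /\ Yt w = k]) - 1.

Definition w_pop (p K : nat) (X Xt : 'I_p -> T -> R) (Y Yt : T -> 'I_K)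
  (jl : 'I_p * 'I_p) : R :=
  \sum_(k < K) pi_pop Y k * `|tauk_pop X Xt Y Yt k jl.1 jl.2 - tau_pop X Xt jl.1 jl.2|.

End KIF.

Section Empirical.
Context (R : realType).
Definition n_k (n K : nat) (y : nat -> 'I_K) (k : 'I_K) : nat :=
  \sum_(i < n) (y i == k).

Definition concordant (p : nat) (x : nat -> 'I_p -> R) (i t : nat) (j l : 'I_p) : bool :=
  0 < (x i j - x t j) * (x i l - x t l).

Definition pi_hat (n K : nat) (y : nat -> 'I_K) (k : 'I_K) : R :=
  (n_k n y k)%:R / n%:R.

Definition tau_hat (n p : nat) (x : nat -> 'I_p -> R) (j l : 'I_p) : R :=
  4 / (n%:R * (n%:R - 1)) *
  (\sum_(i < n) \sum_(t < n | (i < t)%N) (concordant x i t j l)%:R) - 1.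

Definition tauk_hat (n p K : nat) (x : nat -> 'I_p -> R) (y : nat -> 'I_K)
  (k : 'I_K) (j l : 'I_p) : R :=
  4 / ((n_k n y k)%:R * ((n_k n y k)%:R - 1)) *
  (\sum_(i < n) \sum_(t < n | (i < t)%N)
      [&& concordant x i t j l, y i == k & y t == k]%:R) - 1.

Definition w_hat (n p K : nat) (x : nat -> 'I_p -> R) (y : nat -> 'I_K)
  (jl : 'I_p * 'I_p) : R :=
  \sum_(k < K) pi_hat n y k * `|tauk_hat n x y k jl.1 jl.2 - tau_hat n x jl.1 jl.2|.

Definition min_on (p : nat) (f : 'I_p * 'I_p -> R) (S : {set 'I_p * 'I_p}) : \bar R :=
  \big[Order.min/+oo%E]_(a in S) (f a)%:E.
Definition max_on (p : nat) (f : 'I_p * 'I_p -> R) (S : {set 'I_p * 'I_p}) : \bar R :=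
  \big[Order.max/-oo%E]_(a in S) (f a)%:E.

Definition gap (p : nat) (f : 'I_p * 'I_p -> R) (S : {set 'I_p * 'I_p}) : \bar R :=
  (min_on f S - max_on f (~: S))%E.
End Empirical.

(* Main.v *)
Require Import Defs.
From HB Require Import structures.
From mathcomp Require Import all_boot all_order all_algebra.
From mathcomp Require Import all_classical all_reals all_analysis.
From mathcomp Require Import measurable_realfun ring lra.
Set Implicit Arguments.
Unset Strict Implicit.
Unset Printing Implicit Defensive.
Import Order.TTheory GRing.Theory Num.Theory.
Import numFieldNormedType.Exports.
Local Open Scope classical_set_scope.
Local Open Scope ring_scope.

(* Idea. Every empirical Kendall coefficient is a U-statistic with a {0,1}-valued
   kernel h on pairs of observations. The edges of the complete graph on Z/n split
   into the n matchings { {i,t} : i + t = c }; along a matching the variables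
   h(Z_i, Z_t) are i.i.d. Bernoulli(q), so a multiplicative Chernoff bound with
   q <= Q and a union bound over c give deviation d Q n^2 with failure
   probability 2 n exp(- n Q d^2 / 8). For the kernels restricted to class k one
   takes Q = pi_k^2, of order K^-2, and a relative error d in the
   within-class counts suffices to compare hat tau_k with tau_k.  Hence all
   hat w_{j,l} are uniformly close to w_{j,l} except with probability
   O(p^2 K n exp(- rho n / K^2)), which is O(n^-2) because log p and log n are
   o(n / K^2); Borel-Cantelli and (C5) conclude. *)

(** * Exceptional sets, Dynkin extension and a Chernoff bound *)

Section Probability.
Context (R : realType) (dT : measure_display) (T : measurableType dT)
        (P : probability T R).

Lemma PrE (A : set T) : measurable A -> P A = (Pr P A)%:E.
Proof. by move=> mA; rewrite fineK// fin_num_measure. Qed.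

Lemma Pr_ge0 (A : set T) : 0 <= Pr P A.
Proof. by apply: fine_ge0; exact: measure_ge0. Qed.

Lemma Pr_setT : Pr P setT = 1.
Proof. by rewrite /Pr probability_setT. Qed.

Lemma Pr_set0 : Pr P set0 = 0.
Proof. by rewrite /Pr measure0. Qed.

Lemma le_Pr (A B : set T) : measurable A -> measurable B -> A `<=` B ->
  Pr P A <= Pr P B.
Proof.
by move=> mA mB AB; rewrite -lee_fin -!PrE//; apply: le_measure; rewrite ?inE.
Qed.

Lemma Pr_le1 (A : set T) : measurable A -> Pr P A <= 1.
Proof. by move=> mA; rewrite -lee_fin -PrE//; exact: probability_le1. Qed.

Lemma PrID (F A : set T) : measurable F -> measurable A ->
  Pr P (F `&` ~` A) = Pr P F - Pr P (F `&` A).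
Proof.
move=> mF mA; rewrite -setDE.
have /(congr1 (@fine _)) := measureDI P mF mA.
have [mI mD] := (measurableI _ _ mF mA, measurableD mF mA).
rewrite fineD ?fin_num_measure//.
by rewrite /Pr => ->; rewrite addrK.
Qed.

Lemma PrC (A : set T) : measurable A -> Pr P (~` A) = 1 - Pr P A.
Proof.
move=> mA; have := PrID measurableT mA; rewrite !setTI => ->.
by rewrite Pr_setT.
Qed.

Lemma Pr_bigsetU_le (I : Type) (r : seq I) (D : pred I) (F : I -> set T) :
  (forall i, measurable (F i)) ->
  Pr P (\big[setU/set0]_(i <- r | D i) F i) <= \sum_(i <- r | D i) Pr P (F i).
Proof.
move=> mF; elim: r => [|i r IH]; first by rewrite !big_nil Pr_set0.
rewrite !big_cons; case: ifP => // _; apply: (@le_trans _ _ (Pr P (F i) + Pr P (\big[setU/set0]_(i <- r | D i) F i))); last by rewrite lerD2l.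
have mr : measurable (\big[setU/set0]_(i <- r | D i) F i) by exact: bigsetU_measurable.
by rewrite -lee_fin EFinD -!PrE//; [exact: measureU2|exact: measurableU].
Qed.

(* The exceptional set is existential so that [G] need not be measurable. *)
Definition fails_within (e : R) (G : T -> Prop) : Prop :=
  exists B, [/\ measurable B, Pr P B <= e & forall w, ~ B w -> G w].

Lemma fails_within_forall (I : finType) (e : R) (G : I -> T -> Prop) :
  (forall i, fails_within e (G i)) ->
  fails_within (#|I|%:R * e) (fun w => forall i, G i w).
Proof.
move=> /choice[B BP].
exists (\big[setU/set0]_i B i); split.
- by apply: bigsetU_measurable => i _; case: (BP i).
- apply: (le_trans (Pr_bigsetU_le _ _ _)); first by move=> i; case: (BP i).
  by rewrite mulr_natl -sumr_const; apply: ler_sum => i _; case: (BP i).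
- move=> w; rewrite -bigcup_seq => nB i; case: (BP i) => _ _; apply => Bi.
  by apply: nB; exists i => //=; rewrite mem_index_enum.
Qed.

Lemma fails_within_sub (e e' : R) (G G' : T -> Prop) :
  e <= e' -> (forall w, G w -> G' w) ->
  fails_within e G -> fails_within e' G'.
Proof.
move=> ee GG [B [mB BE BG]]; exists B; split => //; first exact: le_trans ee.
by move=> w /BG /GG.
Qed.

Lemma fails_within_and (e e' : R) (G G' : T -> Prop) :
  fails_within e G -> fails_within e' G' ->
  fails_within (e + e') (fun w => G w /\ G' w).
Proof.
move=> [B [mB BE BG]] [B' [mB' BE' BG']]; exists (B `|` B'); split.
- exact: measurableU.
- apply: (@le_trans _ _ (Pr P B + Pr P B')); last exact: lerD.
  by rewrite -lee_fin EFinD -!PrE//; [exact: measureU2|exact: measurableU].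
- by move=> w /not_orP[/BG ? /BG'].
Qed.

Lemma measurable_bigcap_fin (I : finType) (F : I -> set T) :
  (forall i, measurable (F i)) -> measurable (\bigcap_i F i).
Proof. by move=> mF; apply: fin_bigcap_measurable => //; exact: finite_finset. Qed.

Lemma measurable_preim d (Z : measurableType d) (U : T -> Z) (C : set Z) :
  measurable_fun setT U -> measurable C -> measurable (U @^-1` C).
Proof. by move=> mU mC; rewrite -[X in measurable X]setTI; exact: mU. Qed.

(** Both sides respect complements and countable disjoint unions; the complement step uses that
    [G setT] forces [a] to be the probability of [F]. With [F = setT] and [a = 1] this extends an
    equality of laws from generators; with [F] an event about other variables it extends
    independence. *)
Lemma Pr_preim_dynkin d (Z : measurableType d) (G : set (set Z)) (F : set T)
    (a : R) (U V : T -> Z) :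
  measurable = <<s G >> -> setI_closed G -> G setT ->
  measurable F -> measurable_fun setT U -> measurable_fun setT V ->
  (forall C, G C -> Pr P (F `&` U @^-1` C) = a * Pr P (V @^-1` C)) ->
  forall C, measurable C -> Pr P (F `&` U @^-1` C) = a * Pr P (V @^-1` C).
Proof.
move=> mG GI GT mF mU mV GE.
have aE : a = Pr P F.
  by have := GE _ GT; rewrite !preimage_setT setIT Pr_setT mulr1.
have mUC C : measurable C -> measurable (U @^-1` C) by exact: measurable_preim.
have mVC C : measurable C -> measurable (V @^-1` C) by exact: measurable_preim.
suff H : forall C, <<s G >> C -> Pr P (F `&` U @^-1` C) = a * Pr P (V @^-1` C).
  by move=> C; rewrite mG => /H.
apply: (dynkin_induction (G := G)) => //; first exact: GE.
  move=> C mC CE; rewrite -!preimage_setC (PrID mF (mUC _ mC)) (PrC (mVC _ mC)).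
  by rewrite CE mulrBr mulr1 -aE.
move=> C mC tC CE; apply: EFin_inj; rewrite EFinM -!PrE; last 2 first.
- by apply: mVC; exact: bigcupT_measurable.
- by apply: measurableI => //; apply: mUC; exact: bigcupT_measurable.
rewrite !preimage_bigcup setI_bigcupr !measure_bigcup//.
- rewrite -nneseriesZl//.
  apply: eq_eseriesr => k _; apply: (etrans (PrE (measurableI _ _ mF (mUC _ (mC k))))).
  by rewrite CE EFinM -(PrE (mVC _ (mC k))).
- by move=> k _; exact: mVC.
- apply/trivIsetP => i j _ _ ij; rewrite -preimage_setI.
  by move/trivIsetP : tC => ->//; rewrite preimage_set0.
- by move=> k _; apply: measurableI => //; exact: mUC.
- apply/trivIsetP => i j _ _ ij; rewrite setIACA.
  rewrite -[X in _ `&` X]preimage_setI.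
  by move/trivIsetP : tC => ->//; rewrite preimage_set0 setI0.
Qed.

(* Generators are replaced by arbitrary measurable sets one index at a time;
   [s] lists the indices already treated. *)
Lemma indep_sigma (I : finType) d (Z : measurableType d) (G : set (set Z))
    (W : I -> T -> Z) :
  measurable = <<s G >> -> setI_closed G -> G setT ->
  (forall i, measurable_fun setT (W i)) ->
  (forall B : I -> set Z, (forall i, G (B i)) ->
    Pr P (\bigcap_i (W i @^-1` B i)) = \prod_i Pr P (W i @^-1` B i)) ->
  forall B : I -> set Z, (forall i, measurable (B i)) ->
    Pr P (\bigcap_i (W i @^-1` B i)) = \prod_i Pr P (W i @^-1` B i).
Proof.
move=> mG GI GT mW GE.
have Gm C : G C -> measurable C by rewrite mG; exact: sub_sigma_algebra.
suff H (s : seq I) : forall B : I -> set Z, (forall i, measurable (B i)) ->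
    (forall i, i \notin s -> G (B i)) ->
    Pr P (\bigcap_i (W i @^-1` B i)) = \prod_i Pr P (W i @^-1` B i).
  by move=> B mB; apply: (H (enum I)) => // i; rewrite mem_enum.
elim: s => [|i s IH] B mB GB; first by apply: GE => i; exact: GB.
(* Isolating the factor at [i] leaves a fixed event and a fixed product over the other indices,
   which serve as [F] and [a] in the Dynkin argument. *)
pose upd C j := if j == i then C else B j.
have updE C : \bigcap_j (W j @^-1` upd C j) =
    (\bigcap_(j in [set j | j != i]) (W j @^-1` B j)) `&` W i @^-1` C.
  apply/seteqP; split => w.
    move=> H; split; last by have := H i Logic.I; rewrite /upd eqxx.
    by move=> j /= /negbTE ji; have := H j Logic.I; rewrite /upd ji.
  by move=> [H Hi] j _; rewrite /upd; case: eqVneq => [->//|ji]; exact: H.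
have prodE C : \prod_j Pr P (W j @^-1` upd C j) =
    (\prod_(j | j != i) Pr P (W j @^-1` B j)) * Pr P (W i @^-1` C).
  rewrite (bigD1 i)//= /upd eqxx mulrC; congr (_ * _).
  by apply: eq_bigr => j /negbTE ->.
have -> : B = upd (B i) by apply/funext => j; rewrite /upd; case: eqVneq => [->|].
rewrite updE prodE.
apply: (Pr_preim_dynkin mG) => //.
  apply: fin_bigcap_measurable => [|j _]; last exact: measurable_preim.
  exact: finite_finset.
move=> C GC; rewrite -updE -prodE; apply: IH => j; rewrite /upd.
  by case: eqP => // _; exact: Gm.
by case: eqVneq => // ji js; apply: GB; rewrite inE negb_or ji.
Qed.

(** From [1 - s <= expR (- s)] one gets the bound $1/(1-s)$, and $(1-s)(1+s+2s^2) = 1 + s^2(1-2s)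
    \ge 1$ for $s \le 1/2$. *)
Lemma expR_le_quad (s : R) : `|s| <= 1 / 2 -> expR s <= 1 + (s + 2 * s ^+ 2).
Proof.
rewrite ler_norml => /andP[s1 s2].
have e : 1 - s <= expR (- s) by exact: expR_ge1Dx.
have s0 : 0 < 1 - s by lra.
have -> : expR s = (expR (- s))^-1 by rewrite expRN invrK.
rewrite (le_trans (_ : _ <= (1 - s)^-1))//.
  by rewrite lef_pV2// posrE ?expR_gt0.
rewrite -[leLHS]mul1r ler_pdivrMr//; nra.
Qed.

(** Independence is given through the atoms of the finite algebra generated by the events, so that
    every expectation is a finite sum over [b]. The exponent is linear in [Q]; this matters when [Q]
    is of order $K^{-2}$, where a bound of Hoeffding type would lose another factor $K^{-2}$. *)
Lemma chernoff_two_sided (I : finType) (E : I -> set T) (q Q δ : R) (n : nat) :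
  (forall i, measurable (E i)) ->
  (forall b : {ffun I -> bool},
    Pr P (\bigcap_i (if b i then E i else ~` E i)) =
    \prod_i (if b i then q else 1 - q)) ->
  0 <= q -> q <= 1 -> q <= Q -> 0 <= δ -> δ <= 2 -> (#|I| <= n)%N ->
  fails_within (2 * expR (- (n%:R * Q * δ ^+ 2 / 8)))
    (fun w => `|\sum_i (w \in E i)%:R - #|I|%:R * q| < δ * Q * n%:R).
Proof.
move=> mE EE q0 q1 qQ d0 d2 In.
pose cnt (b : {ffun I -> bool}) : R := \sum_i (b i)%:R.
pose cell (b : {ffun I -> bool}) := \bigcap_i (if b i then E i else ~` E i).
pose bad b := δ * Q * n%:R <= `|cnt b - #|I|%:R * q|.
have mcell b : measurable (cell b).
  by apply: measurable_bigcap_fin => i; case: (b i) => //; exact: measurableC.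
exists (\big[setU/set0]_(b | bad b) cell b).
split; [exact: bigsetU_measurable| |]; last first.
  move=> w; rewrite -bigcup_seq_cond => nw; rewrite ltNge; apply/negP => bw.
    apply: nw; exists [ffun i => w \in E i] => /=.
      rewrite mem_index_enum/= /bad /cnt.
      by under eq_bigr do rewrite ffunE.
    by move=> i _; rewrite ffunE; case: ifPn => [/set_mem//|/negP wE /mem_set].
apply: (le_trans (Pr_bigsetU_le _ _ _)) => //.
(* The choice $l = \delta/4$ minimises $-lt + 2l^2nQ$, with value $-nQ\delta^2/8$; $\delta \le 2$
   keeps $l \le 1/2$. *)
pose l := δ / 4; pose t := δ * Q * n%:R.
have Q0 : 0 <= Q by exact: le_trans qQ.
(* The sum over [b] factors into $(1 - q + q e^s)^{|I|}$. Centring cancels the linear term of the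
   quadratic bound, and $|I| q \le nQ$ bounds the rest. *)
have mgf s : `|s| <= 1 / 2 ->
    \sum_b Pr P (cell b) * expR (s * (cnt b - #|I|%:R * q)) <=
    expR (n%:R * Q * (2 * s ^+ 2)).
  move=> hs.
  have -> : \sum_b Pr P (cell b) * expR (s * (cnt b - #|I|%:R * q)) =
      expR (- (s * #|I|%:R * q)) * (1 - q + q * expR s) ^+ #|I|.
    rewrite -prodr_const.
    have -> : 1 - q + q * expR s = \sum_(x : bool) (if x then q * expR s else 1 - q).
      by rewrite big_bool/= addrC.
    rewrite bigA_distr_bigA big_distrr/=; apply: eq_bigr => b _.
    have -> : s * (cnt b - #|I|%:R * q) = - (s * #|I|%:R * q) + s * cnt b by ring.
    rewrite EE expRD mulrCA; congr (_ * _).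
    rewrite /cnt big_distrr/= expR_sum -big_split/=; apply: eq_bigr => i _.
    by case: (b i); rewrite /= ?(mulr1, mulr0) ?expR0 ?mulr1.
  have h : 1 - q + q * expR s <= expR (q * (s + 2 * s ^+ 2)).
    apply: le_trans (expR_ge1Dx _); have := expR_le_quad hs; nra.
  rewrite (le_trans (_ : _ <= expR (- (s * #|I|%:R * q)) * expR (q * (s + 2 * s ^+ 2)) ^+ #|I|))//.
    rewrite ler_wpM2l ?expR_ge0// lerXn2r// nnegrE ?expR_ge0//.
    by rewrite addr_ge0 ?subr_ge0// mulr_ge0 ?expR_ge0.
  rewrite -expRM_natl -expRD ler_expR.
  have -> : - (s * #|I|%:R * q) + #|I|%:R * (q * (s + 2 * s ^+ 2)) =
    (#|I|%:R * q) * (2 * s ^+ 2) by ring.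
  apply: ler_wpM2r; first by rewrite mulr_ge0 ?sqr_ge0.
  by apply: ler_pM; rewrite ?ler_nat.
have hl : `|l| <= 1 / 2 by rewrite ger0_norm /l; lra.
(* Markov's inequality for both tails at once: on a bad cell one of the two exponentials is at least
   [expR (l * t)]. *)
apply: (@le_trans _ _ (\sum_b Pr P (cell b) *
    (expR (- (l * t)) * (expR (l * (cnt b - #|I|%:R * q)) + expR (- l * (cnt b - #|I|%:R * q)))))).
  rewrite big_mkcond/=; apply: ler_sum => b _; case: ifPn => [bb|_]; last first.
    by rewrite !mulr_ge0 ?Pr_ge0 ?addr_ge0 ?expR_ge0.
  rewrite ler_peMr ?Pr_ge0// mulrDr -!expRD.
  have l0 : 0 <= l by rewrite /l; lra.
  move: bb; rewrite /bad -/t ler_normr => /orP[h|h].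
    rewrite (le_trans (_ : _ <= expR (- (l * t) + l * (cnt b - #|I|%:R * q)))) ?lerDl ?expR_ge0//.
    have : 0 <= l * (cnt b - #|I|%:R * q - t) by rewrite mulr_ge0// subr_ge0.
    by move=> ?; rewrite -[leLHS]expR0 ler_expR; lra.
  rewrite (le_trans (_ : _ <= expR (- (l * t) + - l * (cnt b - #|I|%:R * q)))) ?lerDr ?expR_ge0//.
  have : 0 <= l * (- (cnt b - #|I|%:R * q) - t) by rewrite mulr_ge0// subr_ge0.
  by move=> ?; rewrite -[leLHS]expR0 ler_expR; lra.
under eq_bigr do rewrite mulrCA mulrDr.
rewrite -big_distrr/= big_split/=.
apply: (@le_trans _ _ (expR (- (l * t)) * (expR (n%:R * Q * (2 * l ^+ 2)) + expR (n%:R * Q * (2 * l ^+ 2))))).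
  by rewrite ler_wpM2l ?expR_ge0// lerD ?mgf// -[in leRHS]sqrrN mgf// normrN.
rewrite mulrDr -expRD -[leLHS]mulr2n -[leLHS]mulr_natl.
by apply: ler_wpM2l => //; rewrite ler_expR /t /l; nra.
Qed.

End Probability.

(** * Pairs of observations and matchings of the complete graph *)

Definition pair_obs (I A B : Type) (Z : I -> A -> B) (i t : I) (w : A) : B * B :=
  (Z i w, Z t w).

(* The pairs [i < t] with [i + t = c] modulo [m.+1] are pairwise disjoint. *)
Definition matching (m : nat) (c : 'I_m.+1) :=
  {i : 'I_m.+1 | (i < (c - i)%R)%N}.

Section PairwiseSample.
Context (R : realType) (dT : measure_display) (T : measurableType dT)
        (P : probability T R).
Context (m : nat) (dZ : measure_display) (Zt : measurableType dZ).
Local Notation n := m.+1.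
Variable Z : 'I_n -> T -> Zt.
Hypothesis mZ : forall i, measurable_fun setT (Z i).
Hypothesis indepZ : forall B : 'I_n -> set Zt, (forall i, measurable (B i)) ->
  Pr P (\bigcap_i (Z i @^-1` B i)) = \prod_i Pr P (Z i @^-1` B i).
Hypothesis eqZ : forall i j B, measurable B ->
  Pr P (Z i @^-1` B) = Pr P (Z j @^-1` B).

Let rect := [set A `*` B | A in @measurable _ Zt & B in @measurable _ Zt].

Let rectI : setI_closed rect.
Proof.
move=> _ _ [A1 mA1 [A2 mA2 <-]] [B1 mB1 [B2 mB2 <-]].
exists (A1 `&` B1); first exact: measurableI.
by exists (A2 `&` B2); [exact: measurableI|rewrite setXI].
Qed.

Let rectT : rect setT.
Proof. by exists setT => //; exists setT => //; rewrite setXTT. Qed.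

Let mrect : @measurable _ (Zt * Zt)%type = <<s rect >>.
Proof. exact: measurable_prod_measurableType. Qed.


Let mZ2 i t : measurable_fun setT (pair_obs Z i t).
Proof. exact: measurable_fun_pair. Qed.

Let mpre i B : measurable B -> measurable (Z i @^-1` B).
Proof. exact: measurable_preim. Qed.

Lemma Pr_pair (i t : 'I_n) (A B : set Zt) : i != t ->
  measurable A -> measurable B ->
  Pr P (Z i @^-1` A `&` Z t @^-1` B) = Pr P (Z i @^-1` A) * Pr P (Z t @^-1` B).
Proof.
move=> it mA mB.
pose C s := if s == i then A else if s == t then B else setT.
have := indepZ (B := C); rewrite (bigD1 i)//= (bigD1 t) 1?eq_sym//= big1; last first.
  by move=> s /andP[/negbTE si /negbTE st]; rewrite /C si st preimage_setT Pr_setT.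
have Ci : C i = A by rewrite /C eqxx.
have Ct : C t = B by rewrite /C eqxx eq_sym (negbTE it).
rewrite mulr1 Ci Ct => <-; last first.
  by move=> s; rewrite /C; case: ifP => // _; case: ifP.
congr (Pr P _); apply/seteqP; split => w.
  by move=> [Ai Bt] s _; rewrite /C; case: eqVneq => [->//|_]; case: eqVneq => [->//|].
by move=> H; rewrite -Ci -Ct; split; exact: H.
Qed.

Lemma Pr_pair_law (i t i' t' : 'I_n) (A : set (Zt * Zt)) : i != t -> i' != t' ->
  measurable A -> Pr P (pair_obs Z i t @^-1` A) = Pr P (pair_obs Z i' t' @^-1` A).
Proof.
move=> it it' mA; rewrite -[in LHS](setTI (_ @^-1` _)) -[RHS]mul1r.
apply: (Pr_preim_dynkin mrect) => // _ [B1 mB1 [B2 mB2 <-]].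
rewrite setTI mul1r.
have E j s : pair_obs Z j s @^-1` (B1 `*` B2) = Z j @^-1` B1 `&` Z s @^-1` B2.
  by apply/seteqP; split.
by rewrite !E !Pr_pair// (eqZ i i')// (eqZ t t').
Qed.

Lemma matching_neq (c : 'I_n) (u : matching c) : val u != c - val u.
Proof. by rewrite neq_ltn (valP u). Qed.

(** It suffices to treat rectangles. As the pairs are disjoint, the constraints they impose can be
    regrouped into one constraint per index, to which the independence of the single observations
    applies. *)
Lemma indep_matching (c : 'I_n) (B : matching c -> set (Zt * Zt)) :
  (forall u, measurable (B u)) ->
  Pr P (\bigcap_u (pair_obs Z (val u) (c - val u) @^-1` B u)) =
  \prod_u Pr P (pair_obs Z (val u) (c - val u) @^-1` B u).
Proof.
apply: (indep_sigma (W := fun u : matching c => pair_obs Z (val u) (c - val u)) mrect) => // {}B.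
move=> rB.
have /choice[AD ADP] : forall u, exists AD : set Zt * set Zt,
    [/\ measurable AD.1, measurable AD.2 & AD.1 `*` AD.2 = B u].
  by move=> u; have [A mA [D mD <-]] := rB u; exists (A, D).
(* An index that is not the lower end of a pair gets the void constraint [setT]. *)
pose ext (F : matching c -> set Zt) (i : 'I_n) := oapp F setT (insub i).
have extE F (u : matching c) : ext F (val u) = F u by rewrite /ext valK.
have extT F (i : 'I_n) : ~~ (i < (c - i)%R)%N -> ext F i = setT.
  by move=> /negbTE ni; rewrite /ext insubF.
have mext F (i : 'I_n) : (forall u, measurable (F u)) -> measurable (ext F i).
  by move=> mF; rewrite /ext; case: insub => //=.
pose A := ext (fun u => (AD u).1); pose D := ext (fun u => (AD u).2).
have mA i : measurable (A i) by apply: mext => u; case: (ADP u).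
have mD i : measurable (D i) by apply: mext => u; case: (ADP u).
have cK (i : 'I_n) : c - (c - i) = i by rewrite opprB addrC subrK.
(* The index [i] is constrained by [A i] as the lower end of its pair, or by [D (c - i)] as the
   upper end of the pair starting at [c - i]. At most one of the two is nontrivial, and neither is
   when [c - i = i]. *)
pose C i := A i `&` D (c - i).
have mC i : measurable (C i) by exact: measurableI.
have WE u : pair_obs Z (val u) (c - val u) @^-1` B u =
    Z (val u) @^-1` A (val u) `&` Z (c - val u) @^-1` D (val u).
  by have [_ _ <-] := ADP u; rewrite /A /D !extE; apply/seteqP; split.
have -> : \bigcap_u (pair_obs Z (val u) (c - val u) @^-1` B u) =
    \bigcap_i (Z i @^-1` C i).
  apply/seteqP; split => w H i _.
    split.
      have [ic|ic] := boolP (i < (c - i)%R)%N; last by rewrite /= /A extT.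
      by have := H (Sub i ic) Logic.I; rewrite WE => -[].
    have [ic|ic] := boolP ((c - i)%R < (c - (c - i))%R)%N; last by rewrite /= /D extT.
    by have := H (Sub (c - i) ic) Logic.I; rewrite WE SubK cK => -[].
  rewrite WE; split; first by have [] := H (val i) Logic.I.
  by have := H (c - val i) Logic.I; rewrite /C /= cK => -[].
rewrite indepZ//.
transitivity (\prod_i (Pr P (Z i @^-1` A i) * Pr P (Z i @^-1` D (c - i)))).
  apply: eq_bigr => i _; rewrite /C.
  have [ic|ic] := boolP (i < (c - i)%R)%N.
    by rewrite /D extT ?setIT ?preimage_setT ?Pr_setT ?mulr1// cK -leqNgt ltnW.
  by rewrite /A extT// setTI preimage_setT Pr_setT mul1r.
rewrite big_split/= [X in _ * X](reindex_inj (h := fun i => c - i)); last first.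
  by move=> i j /= /(congr1 (fun x => c - x)); rewrite !cK.
rewrite -big_split/= (bigID [pred i : 'I_n | (i < (c - i)%R)%N])/= [X in _ * X]big1 ?mulr1.
  rewrite (big_sub [pred i : 'I_n | (i < (c - i)%R)%N])/=; apply: eq_bigr => u _.
  by rewrite WE cK Pr_pair//; exact: matching_neq.
by move=> i ic; rewrite cK /A /D !extT// !preimage_setT Pr_setT mulr1.
Qed.

(** Each pair [i < t] occurs in exactly one matching, that of [c = i + t] modulo [n]. *)
Lemma pair_sum_matching (V : nmodType) (h : 'I_n -> 'I_n -> V) :
  \sum_(i < n) \sum_(t < n | (i < t)%N) h i t = \sum_c \sum_(u : matching c) h (val u) (c - val u).
Proof.
under [RHS]eq_bigr => c _ do
  rewrite -(big_sub [pred i : 'I_n | (i < (c - i)%R)%N] (fun i => h i (c - i)))/=.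
rewrite [RHS](exchange_big_dep xpredT)//=; apply: eq_bigr => i _.
by rewrite (reindex_inj (h := fun c => c - i))// => c c' /= /addIr.
Qed.

(** The Chernoff bound applies within each of the [n] matchings, which has at most [n] pairs. The
    [n] deviations $\delta Q n$ add up, and so do the [n] failure probabilities. *)
Lemma pair_sum_concentration (A : set (Zt * Zt)) (q Q δ : R) :
  measurable A -> (forall i t, i != t -> Pr P (pair_obs Z i t @^-1` A) = q) ->
  0 <= q -> q <= 1 -> q <= Q -> 0 <= δ -> δ <= 2 ->
  fails_within P (n%:R * (2 * expR (- (n%:R * Q * δ ^+ 2 / 8))))
    (fun w => `|\sum_(i < n) \sum_(t < n | (i < t)%N) (pair_obs Z i t w \in A)%:R -
               (\sum_(i < n) \sum_(t < n | (i < t)%N) 1) * q| <= δ * Q * n%:R ^+ 2).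
Proof.
move=> mA qE q0 q1 qQ d0 d2.
have H c := @chernoff_two_sided _ _ _ P (matching c)
  (fun u => pair_obs Z (val u) (c - val u) @^-1` A) q Q δ n.
have {}H c : fails_within P (2 * expR (- (n%:R * Q * δ ^+ 2 / 8)))
    (fun w => `|\sum_(u : matching c) (pair_obs Z (val u) (c - val u) w \in A)%:R -
               (\sum_(u : matching c) 1) * q| <= δ * Q * n%:R).
  have mZA u : measurable (pair_obs Z (val (u : matching c)) (c - val u) @^-1` A).
    exact: measurable_preim.
  apply: fails_within_sub (H c _ _ _ _ _ _ _ _) => // [w|b|].
  - move=> /ltW Hw; rewrite sumr_const; apply: le_trans Hw.
    rewrite le_eqVlt; apply/orP; left; apply/eqP; congr (`|_ - _|).
  - have := @indep_matching c (fun u => if b u then A else ~` A).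
    have E u : pair_obs Z (val u) (c - val u) @^-1` (if b u then A else ~` A) =
        if b u then pair_obs Z (val u) (c - val u) @^-1` A else ~` (pair_obs Z (val u) (c - val u) @^-1` A).
      by case: ifP.
    under eq_bigcapr do rewrite E.
    move=> ->; last by move=> u; case: ifP => // _; exact: measurableC.
    apply: eq_bigr => u _; rewrite E; case: ifP => _; first exact/qE/matching_neq.
    by rewrite PrC// qE//; exact: matching_neq.
  - by rewrite card_sig -[leqRHS]card_ord max_card.
have := fails_within_forall H; rewrite card_ord.
apply: fails_within_sub => // w Hw.
rewrite !pair_sum_matching mulr_suml -sumrB.
apply: (le_trans (ler_norm_sum _ _ _)).
apply: (le_trans (ler_sum _ (fun c _ => Hw c))).
by rewrite sumr_const card_ord -[leLHS]mulr_natr expr2 mulrA.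
Qed.

End PairwiseSample.

(** * The measurable space of observations *)

HB.instance Definition _ (m : nat) := isPointed.Build 'I_m.+1 ord0.

Section Observations.
Context (R : realType) (p m : nat).

Definition obs_cdf (a : 'I_p -> R) (k : 'I_m.+1) : set (('I_p -> R) * 'I_m.+1) :=
  [set z | (forall j, z.1 j <= a j) /\ z.2 = k].

(* [set0] and [setT] are added to make the distribution-function events a
   pi-system that contains the full set. *)
Definition obs_gen : set (set (('I_p -> R) * 'I_m.+1)) :=
  [set A | [\/ A = set0, A = setT | exists a k, A = obs_cdf a k]].

(** The sigma-algebra is generated by the events that [sample_iid] speaks of, so laws and
    independence extend to it directly. The price is that the measurability of classes and
    coordinates has to be derived. *)
Definition obs := g_sigma_algebraType obs_gen.

HB.instance Definition _ := Measurable.on obs.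

Lemma obs_genI : setI_closed obs_gen.
Proof.
move=> _ _ [->|->|[a [k ->]]] [->|->|[a' [k' ->]]];
  rewrite ?set0I ?setI0 ?setTI ?setIT; try by constructor.
- by constructor 3; exists a', k'.
- by constructor 3; exists a, k.
- have [kk|/eqP kk] := eqVneq k k'; last first.
    constructor 1; apply/seteqP; split => // z [[_ zk] [_ zk']].
    by apply: kk; rewrite -zk -zk'.
  constructor 3; exists (fun j => Num.min (a j) (a' j)), k.
  apply/seteqP; split => z.
    by move=> [[za zk] [za' _]]; split => // j; rewrite le_min za za'.
  move=> [za zk]; split; split; rewrite -?kk// => j;
    by have := za j; rewrite le_min => /andP[].
Qed.

Lemma obs_genT : obs_gen setT. Proof. by constructor 2. Qed.

Lemma obs_measurableE : @measurable _ obs = <<s (obs_gen : set (set obs)) >>.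
Proof. by []. Qed.

Lemma measurable_obs_cdf a k : measurable (obs_cdf a k : set obs).
Proof. by apply: sub_sigma_algebra; constructor 3; exists a, k. Qed.

Lemma measurable_obs_class k : measurable ([set z | z.2 = k] : set obs).
Proof.
rewrite [X in measurable X](_ : _ = \bigcup_N obs_cdf (fun=> N%:R) k).
  by apply: bigcupT_measurable => N; exact: measurable_obs_cdf.
apply/seteqP; split => [z zk|z [N _ []]//].
(* There are finitely many coordinates, so one integer bounds them all. *)
exists (\max_j (Num.truncn `|z.1 j|).+1) => //; split => // j.
rewrite (le_trans (ler_norm _))// ltW// (lt_le_trans (truncnS_gt _))// ler_nat.
exact: leq_bigmax.
Qed.

Lemma measurable_obs_coord j : measurable_fun setT (fun z : obs => z.1 j).
Proof.
apply: (measurability _ (RGenOInfty.measurableE R)) => //.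
move=> _ [_ [x ->] <-]; rewrite setTI.
(* The half-space [z.1 j <= x] is exhausted by distribution-function events with bound [x] at [j]
   and a growing bound [N] at the other coordinates. *)
rewrite [X in measurable X](_ : _ = ~` \bigcup_N \bigcup_(k : 'I_m.+1)
    obs_cdf (fun i => if i == j then x else N%:R) k); last first.
  apply/seteqP; split => z /=; rewrite in_itv/= andbT ltNge.
    move=> /negP xz [N _ [k _ [/(_ j)]]]; by rewrite eqxx.
  move=> nz; apply/negP => zx; apply: nz.
  exists (\max_j (Num.truncn `|z.1 j|).+1) => //; exists z.2 => //; split => // i.
  case: eqVneq => [->//|_].
  rewrite (le_trans (ler_norm _))// ltW// (lt_le_trans (truncnS_gt _))// ler_nat.
  exact: (leq_bigmax (F := fun j => (Num.truncn `|z.1 j|).+1)).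
apply: measurableC; apply: bigcupT_measurable => N.
by apply: fin_bigcup_measurable => [|k _]; [exact: finite_finset|exact: measurable_obs_cdf].
Qed.

Definition concordant_pair (j l : 'I_p) : set (obs * obs) :=
  [set zz | 0 < (zz.1.1 j - zz.2.1 j) * (zz.1.1 l - zz.2.1 l)].

Definition class_pair (k : 'I_m.+1) : set (obs * obs) :=
  [set zz | zz.1.2 = k /\ zz.2.2 = k].

Lemma measurable_concordant_pair j l : measurable (concordant_pair j l).
Proof.
have mfst i : measurable_fun setT (fun zz : obs * obs => zz.1.1 i).
  exact: (measurableT_comp (measurable_obs_coord i) measurable_fst).
have msnd i : measurable_fun setT (fun zz : obs * obs => zz.2.1 i).
  exact: (measurableT_comp (measurable_obs_coord i) measurable_snd).
have mf : measurable_fun setT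
    (fun zz : obs * obs => (zz.1.1 j - zz.2.1 j) * (zz.1.1 l - zz.2.1 l)).
  by apply: measurable_funM; apply: measurable_funB.
rewrite [X in measurable X](_ : _ = (fun zz : obs * obs =>
    (zz.1.1 j - zz.2.1 j) * (zz.1.1 l - zz.2.1 l)) @^-1` `]0, +oo[).
  by apply: measurable_preim mf _; exact: measurable_itv.
by apply/seteqP; split => zz /=; rewrite in_itv/= andbT.
Qed.

Lemma measurable_class_pair k : measurable (class_pair k).
Proof.
rewrite [X in measurable X](_ : _ = [set z : obs | z.2 = k] `*` [set z : obs | z.2 = k]).
  by apply: measurableX; exact: measurable_obs_class.
by apply/seteqP; split.
Qed.

End Observations.

(** * From distribution functions to laws and independence of the observations *)

Section Sample.
Context (R : realType) (dT : measure_display) (T : measurableType dT)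
        (P : probability T R).
Context (n' p K' : nat).
Local Notation n := n'.+1.
Local Notation K := K'.+1.
Context (X : nat -> 'I_p -> T -> R) (Y : nat -> T -> 'I_K).
Hypothesis iid : sample_iid P n X Y.

Definition observation (i : 'I_n) (w : T) : obs R p K' := (X i ^~ w, Y i w).
Local Notation Z := observation.

Let cdfE i a k : Z i @^-1` obs_cdf a k = cdf_event (X i) (Y i) a k.
Proof. by []. Qed.

Let mcdf (i : 'I_n) a k : measurable (cdf_event (X i) (Y i) a k).
Proof.
have [mX mY _ _] := iid.
rewrite [X in measurable X](_ : _ =
    (\bigcap_j (X i j @^-1` `]-oo, a j])) `&` Y i @^-1` [set k]).
  apply: measurableI; last exact: mY.
  apply: measurable_bigcap_fin => j; apply: measurable_preim; first exact: mX.
  exact: measurable_itv.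
apply/seteqP; split => w [Xa Yk]; split => // j.
  by move=> _ /=; rewrite in_itv/=.
by have := Xa j Logic.I; rewrite /= in_itv.
Qed.

Lemma measurable_observation (i : 'I_n) : measurable_fun setT (Z i).
Proof.
apply: (measurability _ (obs_measurableE R p K')) => //.
move=> _ [_ [->|->|[a [k ->]]] <-]; rewrite setTI.
- by rewrite preimage_set0.
- by rewrite preimage_setT.
- by rewrite cdfE.
Qed.

Lemma observation_law (i t : 'I_n) B : measurable B ->
  Pr P (Z i @^-1` B) = Pr P (Z t @^-1` B).
Proof.
move=> mB; rewrite -[in LHS](setTI (_ @^-1` _)) -[RHS]mul1r.
have [_ _ _ E] := iid.
apply: (Pr_preim_dynkin (obs_measurableE R p K')) => //.
- exact: obs_genI.
- exact: obs_genT.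
- exact: measurable_observation.
- exact: measurable_observation.
move=> _ [->|->|[a [k ->]]]; rewrite setTI mul1r.
- by rewrite !preimage_set0.
- by rewrite !preimage_setT.
- by rewrite !cdfE /Pr (E i)// (E t).
Qed.

Lemma observation_indep (B : 'I_n -> set (obs R p K')) :
  (forall i, measurable (B i)) ->
  Pr P (\bigcap_i (Z i @^-1` B i)) = \prod_i Pr P (Z i @^-1` B i).
Proof.
apply: (indep_sigma (obs_measurableE R p K')) => //.
- exact: obs_genI.
- exact: obs_genT.
- exact: measurable_observation.
move=> {}B GB.
have [[i Bi0]|B0] := pselect (exists i, B i = set0).
  rewrite (bigD1 i)//= Bi0 preimage_set0 Pr_set0 mul0r -(Pr_set0 P).
  by congr (Pr P _); apply/seteqP; split => // w /(_ i Logic.I); rewrite Bi0.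
have /choice[ak akE] : forall i, exists ak, B i <> setT -> B i = obs_cdf ak.1 ak.2.
  move=> i; have [Bi|Bi|[a [k Bi]]] := GB i.
  - by exfalso; apply: B0; exists i.
  - by exists (fun=> 0, ord0).
  - by exists (a, k).
(* No distribution-function event equals [setT], so product independence is invoked only on the
   sublist [J] of indices with a proper constraint; the others contribute a factor 1. *)
pose D (i : 'I_n) := `[< B i <> setT >].
pose J := [seq val i | i <- enum 'I_n & D i].
have [_ _ indep _] := iid.
have := indep J _ _ (fun t => (ak (inord t)).1) (fun t => (ak (inord t)).2).
have -> : [set w | forall i, i \in J -> cdf_event (X i) (Y i) (ak (inord i)).1 (ak (inord i)).2 w]
    = \bigcap_i (Z i @^-1` B i).
  apply/seteqP; split => w H.
    move=> i _; have [Di|/asboolPn/contrapT ->//] := boolP (D i).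
    have := H (val i); rewrite inord_val => /(_ _).
    rewrite /= (akE i); last exact/asboolP.
    by apply; apply/mapP; exists i => //; rewrite mem_filter Di mem_enum.
  move=> t /mapP[i]; rewrite mem_filter => /andP[/asboolP Di _] ->.
  by rewrite inord_val; have := H i Logic.I; rewrite /= akE.
rewrite big_map big_filter big_enum_cond/= => HJ; rewrite {1}/Pr HJ.
- under eq_bigr do rewrite inord_val PrE//.
  rewrite prodEFin/= big_mkcond/=; apply: eq_bigr => i _.
  have [Di|/asboolPn/contrapT ->] := boolP (D i).
    by rewrite akE//; exact/asboolP.
  by rewrite preimage_setT Pr_setT.
- by rewrite (map_inj_uniq val_inj) filter_uniq ?enum_uniq.
- by apply/allP => t /mapP[i _ ->]; exact: ltn_ord.
Qed.

End Sample.

(** * Deterministic error propagation from pair counts to scores *)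

Lemma sum_pairs_double (R : pzRingType) (n : nat) (f : 'I_n -> 'I_n -> R) :
  (forall i t, f i t = f t i) ->
  2 * (\sum_(i < n) \sum_(t < n | (i < t)%N) f i t) + \sum_i f i i =
  \sum_i \sum_t f i t.
Proof.
move=> fC.
have -> : \sum_i \sum_t f i t = \sum_(i < n) \sum_(t < n | (i < t)%N) f i t +
    \sum_(i < n) \sum_(t < n | (t < i)%N) f i t + \sum_i f i i.
  rewrite -!big_split/=; apply: eq_bigr => i _.
  rewrite (bigD1 i)//= addrC; congr (_ + _).
  rewrite (bigID [pred t : 'I_n | (i < t)%N])/=; congr (_ + _); apply: eq_bigl => t.
    by rewrite -val_eqE neq_ltn; case: ltngtP.
  by rewrite -val_eqE neq_ltn; case: ltngtP.
congr (_ + _); rewrite mulr_natl mulr2n; congr (_ + _).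
rewrite [RHS](exchange_big_dep xpredT)//=; apply: eq_bigr => i _.
by apply: eq_bigr => t _.
Qed.

Section Deterministic.
Context (R : realType).

(** Since [e <= 1 / 2], the denominator [v] is at least half of [N2 * P]. Numerator and denominator
    then each contribute at most [2 * e], the latter because [q <= P]. *)
Lemma ratio_close (P q u v N2 e : R) : 0 < P -> 0 <= q <= P -> 0 < N2 ->
  e <= 1 / 2 -> `|u - N2 * q| <= e * (N2 * P) -> `|v - N2 * P| <= e * (N2 * P) ->
  `|u / v - q / P| <= 4 * e.
Proof.
move=> P0 /andP[q0 qP] N0 e1 hu hv.
have NP : 0 < N2 * P by exact: mulr_gt0.
have v0 : N2 * P / 2 <= v by move: hv; rewrite ler_norml => /andP[]; nra.
have v1 : 0 < v by apply: lt_le_trans v0; lra.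
have -> : u / v - q / P = ((u - N2 * q) * P - q * (v - N2 * P)) / (v * P).
  by field; rewrite !gt_eqF.
rewrite normrM normfV (gtr0_norm (mulr_gt0 v1 P0)) ler_pdivrMr ?mulr_gt0//.
apply: (le_trans (ler_normB _ _)); rewrite !normrM (gtr0_norm P0) (ger0_norm q0).
have e0 : 0 <= e.
  by rewrite -(pmulr_lge0 _ NP); apply: le_trans hu.
have h1 : `|u - N2 * q| * P <= e * (N2 * P) * P by rewrite ler_wpM2r// ltW.
have h2 : q * `|v - N2 * P| <= P * (e * (N2 * P)) by exact: ler_pM.
have h3 : 4 * e * (N2 * P / 2 * P) <= 4 * e * (v * P).
  by apply: ler_wpM2l; [lra|apply: ler_wpM2r; lra].
lra.
Qed.

(** Here [N2] and [V] stand for the numbers of all pairs and of pairs inside class [k]. Because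
    $n_k^2 = 2V + n_k$, the control of [V] also controls the class frequency [nk / n], so no
    separate concentration of $n_k$ is required. *)
Lemma kif_term_close (n nk V N2 Sc Sk π q qk δ : R) :
  2 <= n -> 0 <= nk <= n -> 2 * N2 + n = n ^+ 2 -> 2 * V + nk = nk ^+ 2 ->
  0 < π <= 1 -> 0 <= q <= 1 -> 0 <= qk <= π ^+ 2 -> 0 <= δ <= 1 / 8 ->
  `|Sc - N2 * q| <= δ * n ^+ 2 ->
  `|Sk - N2 * qk| <= δ * π ^+ 2 * n ^+ 2 ->
  `|V - N2 * π ^+ 2| <= δ * π ^+ 2 * n ^+ 2 ->
  `|nk / n * `|(4 / (nk * (nk - 1)) * Sk - 1) - (4 / (n * (n - 1)) * Sc - 1)| -
    π * `|(2 * (qk / π ^+ 2) - 1) - (2 * q - 1)| | <= 54 * δ * π + 7 / (n * π).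
Proof.
move=> n2 /andP[nk0 nkn] hN hV /andP[π0 π1] hq hqk /andP[d0 d1] hSc hSk hVV.
(* $N_2 = n(n-1)/2 \ge n^2/4$ for $n \ge 2$. Errors relative to $n^2$ thus become errors [4 * δ]
   relative to [N2], and [δ <= 1 / 8] makes [ratio_close] applicable. *)
have nN : n ^+ 2 <= 4 * N2 by nra.
have N0 : 0 < N2 by nra.
have P0 : 0 < π ^+ 2 by rewrite exprn_gt0.
have dn : δ * π ^+ 2 * n ^+ 2 <= 4 * δ * (N2 * π ^+ 2).
  have : 0 <= δ * π ^+ 2 by rewrite mulr_ge0// ltW.
  by move=> /ler_wpM2l /(_ _ _ nN); lra.
have tk : `|Sk / V - qk / π ^+ 2| <= 4 * (4 * δ).
  by apply: (ratio_close (N2 := N2)) => //; [lra|exact: le_trans dn|exact: le_trans dn].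
have tt : `|Sc / N2 - q| <= 4 * δ.
  have -> : Sc / N2 - q = (Sc - N2 * q) / N2 by field; rewrite gt_eqF.
  rewrite normrM normfV (gtr0_norm N0) ler_pdivrMr//.
  by apply: (le_trans hSc); move/(ler_wpM2l d0): nN; lra.
have NP : 0 < N2 * π ^+ 2 by exact: mulr_gt0.
have V0 : 0 < V.
  have : 4 * δ * (N2 * π ^+ 2) <= 1 / 2 * (N2 * π ^+ 2) by apply: ler_wpM2r; lra.
  by move: (le_trans hVV dn); rewrite ler_norml => /andP[]; lra.
have -> : nk * (nk - 1) = 2 * V by move: hV; lra.
have -> : n * (n - 1) = 2 * N2 by move: hN; lra.
have -> : 4 / (2 * V) * Sk = 2 * (Sk / V) by field; rewrite gt_eqF.
have -> : 4 / (2 * N2) * Sc = 2 * (Sc / N2) by field; rewrite gt_eqF.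
have n0 : 0 < n by lra.
have hph : `|nk / n - π| <= 2 * δ * π + 1 / (n * π).
  have ph0 : 0 <= nk / n by rewrite divr_ge0// ltW.
  (* Difference of squares: the second factor is at least [π], so a bound on $(n_k/n)^2 - \pi^2$ may
     be divided by [π]. *)
  suff : `|nk / n - π| * (nk / n + π) <= 2 * δ * π ^+ 2 + 1 / n.
    have h : `|nk / n - π| * π <= `|nk / n - π| * (nk / n + π) by rewrite ler_wpM2l// lerDr.
    move=> /(le_trans h); rewrite -ler_pdivlMr// => /le_trans; apply.
    by rewrite le_eqVlt; apply/orP; left; apply/eqP; field; rewrite !gt_eqF.
  rewrite -[X in _ * X]ger0_norm ?addr_ge0 ?(ltW π0)// -normrM.
  have -> : (nk / n - π) * (nk / n + π) =
      2 / n ^+ 2 * (V - N2 * π ^+ 2) + (nk - n * π ^+ 2) / n ^+ 2.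
    have -> : (nk / n - π) * (nk / n + π) = (nk ^+ 2 - n ^+ 2 * π ^+ 2) / n ^+ 2.
      by field; rewrite gt_eqF.
    by rewrite -hV -{1}hN; field; rewrite gt_eqF.
  have nn0 : 0 < n ^+ 2 by rewrite exprn_gt0.
  apply: (le_trans (ler_normD _ _)); apply: lerD.
    rewrite normrM ger0_norm ?divr_ge0 ?(ltW nn0)//.
    rewrite mulrAC ler_pdivrMr//; lra.
  rewrite normrM normfV (gtr0_norm nn0) ler_pdivrMr//.
  have -> : 1 / n * n ^+ 2 = n by field; rewrite gt_eqF.
  have h1 : 0 <= n * π ^+ 2 by rewrite mulr_ge0// ltW.
  have h2 : n * π ^+ 2 <= n by rewrite ler_piMr ?(ltW n0)// exprn_ile1// ltW.
  by rewrite ler_norml; lra.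
have hb : `|2 * (qk / π ^+ 2) - 1 - (2 * q - 1)| <= 2.
  have /andP[h1 h2] : 0 <= qk / π ^+ 2 <= 1.
    by case/andP: hqk => h1 h2; rewrite divr_ge0 ?(ltW P0)//= ler_pdivrMr// mul1r.
  by rewrite ler_norml; lra.
set a := `|_ - _ - (_ * (Sc / _) - _)|; set b := `|_ - (2 * q - 1)|.
have hab : `|a - b| <= 40 * δ.
  apply: (le_trans (ler_dist_dist _ _)).
  have -> : 2 * (Sk / V) - 1 - (2 * (Sc / N2) - 1) - (2 * (qk / π ^+ 2) - 1 - (2 * q - 1)) =
    2 * (Sk / V - qk / π ^+ 2) - 2 * (Sc / N2 - q) by ring.
  apply: (le_trans (ler_normB _ _)); rewrite !normrM !(ger0_norm (_ : 0 <= 2))//; lra.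
have -> : nk / n * a - π * b = nk / n * (a - b) + (nk / n - π) * b by ring.
have ph0 : 0 <= nk / n by rewrite divr_ge0// ltW.
have b0 : 0 <= b by exact: normr_ge0.
apply: (le_trans (ler_normD _ _)); rewrite (normrM (nk / n)) (normrM (nk / n - π)) (ger0_norm ph0) (ger0_norm b0).
have h1 : nk / n * `|a - b| <= (π + 2 * δ * π + 1 / (n * π)) * (40 * δ).
  apply: ler_pM => //; move: hph; rewrite ler_norml; lra.
have h2 : `|nk / n - π| * b <= (2 * δ * π + 1 / (n * π)) * 2 by exact: ler_pM.
have i0 : 0 <= (n * π)^-1 by rewrite invr_ge0 mulr_ge0// ltW.
(* With [δ <= 1 / 8] the products of errors become linear: $40 + 10 + 4 = 54$ for $\delta\pi$ and $5
   + 2 = 7$ for $1/(n\pi)$. *)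
have dp : 0 <= δ * π by rewrite mulr_ge0// ltW.
have h3 : δ * (δ * π) <= 1 / 8 * (δ * π) by exact: ler_wpM2r.
have h4 : δ * (n * π)^-1 <= 1 / 8 * (n * π)^-1 by exact: ler_wpM2r.
lra.
Qed.

End Deterministic.

(** * Uniform concentration of the empirical scores *)

Section Concentration.
Context (R : realType) (dT : measure_display) (T : measurableType dT)
        (P : probability T R).

(** The sample size [m.+2] guarantees that observations 0 and 1 exist; they play the pair and its
    independent copy in the population quantities. The second conjunct gathers the bounds on these
    quantities that the deterministic comparison requires. *)
Lemma kernel_concentration (m p K' : nat) (X : nat -> 'I_p -> T -> R)
    (Y : nat -> T -> 'I_K'.+1) (j l : 'I_p) (k : 'I_K'.+1) (δ : R) :
  sample_iid P m.+2 X Y -> 0 <= δ <= 2 ->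
  let n := m.+2 in let π := pi_pop P (Y 0%N) k in
  let N2 : R := \sum_(i < n) \sum_(t < n | (i < t)%N) 1 in
  let x w := fun i j => X i j w in let y w := Y^~ w in
  fails_within P (n%:R * (6 * expR (- (n%:R * π ^+ 2 * δ ^+ 2 / 8))))
    (fun w =>
      [/\ `|\sum_(i < n) \sum_(t < n | (i < t)%N) (concordant (x w) i t j l)%:R
            - N2 * Pr P [set w | 0 < (X 0%N j w - X 1%N j w) * (X 0%N l w - X 1%N l w)]|
          <= δ * n%:R ^+ 2,
          `|\sum_(i < n) \sum_(t < n | (i < t)%N)
               [&& concordant (x w) i t j l, y w i == k & y w t == k]%:R
            - N2 * Pr P [set w | 0 < (X 0%N j w - X 1%N j w) * (X 0%N l w - X 1%N l w)
                                 /\ Y 0%N w = k /\ Y 1%N w = k]|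
          <= δ * π ^+ 2 * n%:R ^+ 2 &
          `|\sum_(i < n) \sum_(t < n | (i < t)%N) ((y w i == k) * (y w t == k))%:R
            - N2 * π ^+ 2| <= δ * π ^+ 2 * n%:R ^+ 2]) /\
  [/\ π <= 1, Pr P [set w | Y 0%N w = k /\ Y 1%N w = k] = π ^+ 2,
      Pr P [set w | 0 < (X 0%N j w - X 1%N j w) * (X 0%N l w - X 1%N l w)] <= 1 &
      Pr P [set w | 0 < (X 0%N j w - X 1%N j w) * (X 0%N l w - X 1%N l w)
                                 /\ Y 0%N w = k /\ Y 1%N w = k] <= π ^+ 2].
Proof.
move=> iid /andP[d0 d2] n π N2 x y.
pose Z := observation X Y (n' := m.+1).
have mZ : forall i, measurable_fun setT (Z i) by move=> i; exact: (measurable_observation iid).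
have eqZ : forall i t B, measurable B -> Pr P (Z i @^-1` B) = Pr P (Z t @^-1` B).
  by move=> i t B; exact: (observation_law iid).
have indZ := observation_indep iid.
pose i0 : 'I_n := ord0; pose i1 : 'I_n := lift ord0 ord0.
have i01 : i0 != i1 by [].
have mC := measurable_class_pair k (R := R) (p := p).
have mA := measurable_concordant_pair (R := R) (m := K') j l.
have mAC := measurableI _ _ mA mC.
have mpair (i t : 'I_n) : measurable_fun setT (pair_obs Z i t) by exact: measurable_fun_pair.
have mpre A : measurable A -> measurable (pair_obs Z i0 i1 @^-1` A).
  by move=> ?; exact: measurable_preim.
have law A : measurable A -> forall i t, i != t ->
    Pr P (pair_obs Z i t @^-1` A) = Pr P (pair_obs Z i0 i1 @^-1` A).
  by move=> ? i t it; exact: Pr_pair_law.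
have πE : Pr P (pair_obs Z i0 i1 @^-1` class_pair k) = π ^+ 2.
  have mk : measurable ([set z | z.2 = k] : set (obs R p K')) by exact: measurable_obs_class.
  have := Pr_pair indZ i01 mk mk.
  by rewrite (eqZ i1 i0)// -expr2.
have AE : [set w | 0 < (X 0%N j w - X 1%N j w) * (X 0%N l w - X 1%N l w)] =
    pair_obs Z i0 i1 @^-1` concordant_pair j l by [].
have CE : [set w | Y 0%N w = k /\ Y 1%N w = k] = pair_obs Z i0 i1 @^-1` class_pair k by [].
have ACE : [set w | 0 < (X 0%N j w - X 1%N j w) * (X 0%N l w - X 1%N l w)
      /\ Y 0%N w = k /\ Y 1%N w = k] =
    pair_obs Z i0 i1 @^-1` (concordant_pair j l `&` class_pair k) by [].
have π1 : π <= 1.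
  apply: Pr_le1; have [_ mY _ _] := iid.
  exact: mY.
have π2 : π ^+ 2 <= 1 by rewrite exprn_ile1// Pr_ge0.
have A1 := Pr_le1 P (mpre _ mA).
have ACC : Pr P (pair_obs Z i0 i1 @^-1` (concordant_pair j l `&` class_pair k)) <= π ^+ 2.
  by rewrite -πE; apply: le_Pr; [exact: mpre|exact: mpre|move=> w []].
split; last by split; rewrite ?AE ?CE ?ACE.
have := pair_sum_concentration (Q := 1) mZ indZ mA (law _ mA) (Pr_ge0 _ _) A1 A1 d0 d2.
have := pair_sum_concentration (Q := π ^+ 2) mZ indZ mAC (law _ mAC) (Pr_ge0 _ _) (le_trans ACC π2) ACC d0 d2.
have := pair_sum_concentration (Q := π ^+ 2) mZ indZ mC (fun i t it => etrans (law _ mC i t it) πE) (sqr_ge0 π) π2 (lexx _) d0 d2.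
move=> HC HAC HA.
(* The bound with [Q = 1] is weakened to the exponent of [Q = π ^+ 2], so the three failure
   probabilities sum to the factor 6. *)
apply: fails_within_sub (fails_within_and HA (fails_within_and HAC HC)).
  rewrite -!mulrDr ler_wpM2l//.
  have : expR (- (n%:R * 1 * δ ^+ 2 / 8)) <= expR (- (n%:R * π ^+ 2 * δ ^+ 2 / 8)).
    by rewrite ler_expR lerN2 ler_wpM2r// ler_wpM2r ?sqr_ge0// ler_wpM2l.
  lra.
move=> w [hA [hAC hC]]; split.
- move: hA; rewrite mulr1; congr (`|_ - _| <= _).
  apply: eq_bigr => i _; apply: eq_bigr => t _; congr (_%:R).
  by congr nat_of_bool; apply/idP/idP; rewrite inE.
- move: hAC; congr (`|_ - _| <= _).
  apply: eq_bigr => i _; apply: eq_bigr => t _; congr (_%:R).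
  congr nat_of_bool; apply/idP/idP; rewrite inE.
    by move=> [? [/= h1 h2]]; rewrite /y h1 h2 !eqxx !andbT.
  by move=> /and3P[? /eqP ? /eqP ?]; split.
- move: hC; congr (`|_ - _| <= _).
  apply: eq_bigr => i _; apply: eq_bigr => t _; congr (_%:R).
  rewrite mulnb; congr nat_of_bool; apply/idP/idP; rewrite inE.
    by move=> [/= h1 h2]; rewrite /y h1 h2 !eqxx.
  by move=> /andP[/eqP ? /eqP ?]; split.
Qed.

Lemma w_hat_concentration (n p K : nat) (X : nat -> 'I_p -> T -> R)
    (Y : nat -> T -> 'I_K) (c1 c2 δ : R) :
  (2 <= n)%N -> sample_iid P n X Y -> 0 < c1 ->
  (forall k, c1 / K%:R <= pi_pop P (Y 0%N) k <= c2 / K%:R) -> 0 <= δ <= 1 / 8 ->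
  fails_within P ((p * p * K)%:R * (n%:R * (6 * expR (- (n%:R * (c1 / K%:R) ^+ 2 * δ ^+ 2 / 8)))))
    (fun w => forall jl,
      `|w_hat n (fun i j => X i j w) (fun i => Y i w) jl -
        w_pop P (X 0%N) (X 1%N) (Y 0%N) (Y 1%N) jl|
      <= 54 * δ * c2 + 7 * K%:R ^+ 2 / (n%:R * c1)).
Proof.
case: n => [|[|m]]// _.
case: K Y => [Y|K' Y iid c10 hπ /andP[d0 d1]]; first by case: (Y 0%N point).
have d02 : 0 <= δ <= 2 by rewrite d0/=; lra.
set n := m.+2; set K := K'.+1; set π := fun k => pi_pop P (Y 0%N) k.
have K0 : 0 < K%:R :> R by rewrite ltr0n.
have n0 : 0 < n%:R :> R by rewrite ltr0n.
have q0 : 0 < c1 / K%:R by exact: divr_gt0.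
pose good (I : 'I_p * 'I_p * 'I_K) :=
  fun w => `|pi_hat R n (Y^~ w) I.2 *
     `|tauk_hat n (fun i j => X i j w) (Y^~ w) I.2 I.1.1 I.1.2 -
       tau_hat n (fun i j => X i j w) I.1.1 I.1.2| -
     π I.2 * `|tauk_pop P (X 0%N) (X 1%N) (Y 0%N) (Y 1%N) I.2 I.1.1 I.1.2 -
              tau_pop P (X 0%N) (X 1%N) I.1.1 I.1.2| | <=
     54 * δ * π I.2 + 7 / (n%:R * π I.2).
have Hgood I : fails_within P (n%:R * (6 * expR (- (n%:R * (c1 / K%:R) ^+ 2 * δ ^+ 2 / 8)))) (good I).
  case: I => [[j l] k].
  have [H [π1 CE A1 AC1]] := @kernel_concentration m p K' X Y j l k δ iid d02.
  have π0 : 0 < π k by case/andP: (hπ k) => h _; exact: lt_le_trans h.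
  apply: fails_within_sub H => [|w [hA hAC hC]].
    do 2!apply: ler_wpM2l => //.
    rewrite ler_expR lerN2 ler_wpM2r// ler_wpM2r ?sqr_ge0// ler_wpM2l//.
    by rewrite lerXn2r ?nnegrE ?(ltW q0) ?(ltW π0)//; case/andP: (hπ k).
  rewrite /good /pi_hat /tauk_hat /tau_hat /tauk_pop /tau_pop/= CE.
  apply: kif_term_close hA hAC hC => //.
  - by rewrite ler_nat.
  - rewrite ler0n ler_nat/= /n_k.
    apply: (@leq_trans (\sum_(i < n) 1)); last by rewrite sum1_card card_ord.
    by apply: leq_sum => i _; case: (_ == _).
  - have := @sum_pairs_double R n (fun _ _ => 1) (fun _ _ => erefl).
    have -> : \sum_(i < n) \sum_(t < n) 1 = n%:R ^+ 2 :> R.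
      by rewrite !sumr_const !card_ord -[LHS]mulr_natr expr2.
    by have -> : \sum_(i < n) 1 = n%:R :> R by rewrite sumr_const card_ord.
  - have := @sum_pairs_double R n (fun i t => ((Y i w == k) * (Y t w == k))%:R).
    have nE : (n_k n (Y^~ w) k)%:R = \sum_(i < n) (Y i w == k)%:R :> R by rewrite natr_sum.
    have -> : \sum_(i < n) ((Y i w == k) * (Y i w == k))%:R = (n_k n (Y^~ w) k)%:R :> R.
      by rewrite nE; apply: eq_bigr => i _; case: eqP.
    move=> ->; last by move=> i t; rewrite mulnC.
    rewrite nE expr2 big_distrlr/=; apply: eq_bigr => i _; apply: eq_bigr => t _.
    by rewrite natrM.
  - by rewrite π0.
  - by rewrite Pr_ge0.
  - by rewrite Pr_ge0.
  - by rewrite d0.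
have := fails_within_forall Hgood.
apply: fails_within_sub => [|w Hw jl].
  by rewrite !card_prod !card_ord.
rewrite /w_hat /w_pop -sumrB.
apply: (le_trans (ler_norm_sum _ _ _)).
apply: (le_trans (ler_sum _ (fun k _ => Hw (jl, k)))) => /=.
(* The upper bound on [π k] handles the first term, the lower bound the second; summing [K] copies
   of $K/(n c_1)$ produces the $K^2$. *)
apply: (@le_trans _ _ (\sum_(k < K) (54 * δ * (c2 / K%:R) + 7 / (n%:R * (c1 / K%:R))))).
  apply: ler_sum => k _; case/andP: (hπ k) => h1 h2; apply: lerD.
    by rewrite ler_wpM2l// mulr_ge0.
  have π0 := lt_le_trans q0 h1.
  have [nq nπ] := (mulr_gt0 n0 q0, mulr_gt0 n0 π0).
  by apply: ler_wpM2l => //; rewrite lef_pV2 ?posrE// ler_pM2l.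
rewrite sumr_const card_ord -[leLHS]mulr_natr le_eqVlt; apply/orP; left; apply/eqP.
by field; rewrite !gt_eqF.
Qed.
End Concentration.

(** * The gap functional and lower limits *)

Section Gap.
Context (R : realType).
Local Open Scope ereal_scope.

(** Real pairwise differences replace extended-real extrema. If [S] or its complement is empty the
    gap is [+oo] and the right-hand side is vacuous. *)
Lemma gap_geP (p : nat) (f : 'I_p * 'I_p -> R) (S : {set 'I_p * 'I_p}) (g : R) :
  g%:E <= gap f S <->
  (forall a b, a \in S -> b \notin S -> (g <= f a - f b)%R).
Proof.
split=> [gS a b aS bS|gS].
  rewrite -lee_fin EFinB; apply: le_trans gS _; apply: leeB.
    exact: bigmin_le_cond.
  by apply: le_bigmax_cond; rewrite inE.
have hmax a : a \in S -> max_on f (~: S) <= (f a - g)%:E.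
  move=> aS; apply: bigmax_le => [|b]; first exact: leNye.
  by rewrite inE lee_fin => bS; rewrite lerBrDl -lerBrDr gS.
(* These two bounds exclude the indeterminate differences of infinities. *)
have maxoo : max_on f (~: S) < +oo.
  by rewrite /max_on; elim/big_ind: _ => // [x y xoo yoo|a _]; rewrite ?gt_max ?xoo ?ltry.
have minoo : -oo < min_on f S.
  by rewrite /min_on; elim/big_ind: _ => // [x y xoo yoo|a _]; rewrite ?lt_min ?xoo ?ltNyr.
rewrite /gap; move: maxoo hmax; case: (max_on f _) => [M _ hmax|//|_ _].
  rewrite leeBrDr//; apply: le_bigmin => [|a aS]; first exact: leey.
  by have := hmax a aS; rewrite -EFinD !lee_fin; lra.
by move: minoo; case: (min_on f S) => // [x|] _; rewrite ?leey.
Qed.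

Lemma gap_perturb (p : nat) (f h : 'I_p * 'I_p -> R) (S : {set 'I_p * 'I_p}) (g e : R) :
  (forall a, `|h a - f a| <= e)%R -> g%:E <= gap f S -> (g - 2 * e)%:E <= gap h S.
Proof.
move=> hf /gap_geP gf; apply/gap_geP => a b aS bS; have := gf a b aS bS.
by move: (hf a) (hf b); rewrite !ler_norml; lra.
Qed.

Lemma lt_limn_einf_near (u : (\bar R)^nat) (x : \bar R) :
  x < limn_einf u -> \forall n \near \oo, x <= u n.
Proof.
rewrite limn_einf_lim (cvg_lim _ (@cvg_einfs_sup R u))// => /ereal_sup_gt[_ [N _ <-] xN].
exists N => // n /= Nn; rewrite (le_trans (ltW xN))//.
by apply: ereal_inf_lbound; exists n.
Qed.

Lemma near_le_limn_einf (u : (\bar R)^nat) (x : \bar R) :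
  (\forall n \near \oo, x <= u n) -> x <= limn_einf u.
Proof.
move=> [N _ xN]; rewrite limn_einf_lim (cvg_lim _ (@cvg_einfs_sup R u))//.
apply: (@le_trans _ _ (einfs u N)); last by apply: ereal_sup_ubound; exists N.
by apply: le_ereal_inf_tmp => _ [n Nn <-]; exact: xN.
Qed.

End Gap.

(** * Borel-Cantelli for exceptional sets *)

Section BorelCantelli.
Context (R : realType) (dT : measure_display) (T : measurableType dT)
        (P : probability T R).

(** The weights $c/((n+1)(n+2))$ are summable by telescoping, so the limsup of the exceptional sets
    is null. *)
Lemma ae_near_of_fails_within (G : nat -> T -> Prop) (c : R) :
  (\forall n \near \oo, fails_within P (c / (n.+1%:R * n.+2%:R)) (G n)) ->
  {ae P, forall w, \forall n \near \oo, G n w}.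
Proof.
move=> [N _ GN].
have c0 : 0 <= c.
  have [B [_ BE _]] := GN N (leqnn N).
  by have := le_trans (Pr_ge0 P B) BE; rewrite pmulr_lge0// invr_gt0 mulr_gt0// ltr0n.
have /choice[B BP] : forall n, exists B, [/\ measurable B,
    Pr P B <= c / (n.+1%:R * n.+2%:R) & (N <= n)%N -> forall w, ~ B w -> G n w].
  move=> n; have [Nn|nN] := leqP N n.
    by have [B [mB BE BG]] := GN n Nn; exists B.
  (* Nothing is claimed before rank [N], where the exceptional set can be empty. *)
  exists set0; split; [exact: measurable0| |by []].
  by rewrite Pr_set0 divr_ge0.
have mB n : measurable (B n) by case: (BP n).
have tele M : \sum_(i < M) c / (i.+1%:R * i.+2%:R) = c * (1 - M.+1%:R^-1).
  elim: M => [|M IH]; first by rewrite big_ord0 invr1 subrr mulr0.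
  rewrite big_ord_recr/= IH; field.
  by rewrite -!natr1 !gt_eqF//; have := ler0n R M; lra.
exists (lim_sup_set B); split.
- by apply: bigcapT_measurable => n; apply: bigcup_measurable.
- apply: lim_sup_set_cvg0 => //.
  apply: (@le_lt_trans _ _ c%:E); last exact: ltry.
  apply: lime_le; first exact: is_cvg_nneseries.
  apply: nearW => M; rewrite big_mkord.
  apply: (@le_trans _ _ (\sum_(i < M) (c / (i.+1%:R * i.+2%:R))%:E)%E).
    apply: lee_sum => i _; apply: (@le_trans _ _ (Pr P (B i))%:E).
      by rewrite -PrE.
    by rewrite lee_fin; case: (BP i).
  rewrite sumEFin lee_fin tele.
  have : 0 <= M.+1%:R^-1 :> R by rewrite invr_ge0.
  by move: (M.+1%:R^-1) => v v0; nra.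
- move=> w /= nG; apply: contrapT => nB; apply: nG.
  have [M BM] : exists M, forall k, (M <= k)%N -> ~ B k w.
    apply: contrapT => nM; apply: nB => M _; apply: contrapT => nb.
    by apply: nM; exists M => k Mk Bk; apply: nb; exists k.
  exists (maxn N M) => // n /=; rewrite geq_max => /andP[Nn Mn].
  by have [_ _ H] := BP n; exact/H/BM.
Qed.

End BorelCantelli.

(** Half of the exponent absorbs $p^2$, the other half absorbs $n^4$. With $K \le n$ there remains
    $6/n^2$, and $(n+1)(n+2) \le 6n^2$ for $n \ge 1$. *)
Lemma bad_event_bound (R : realType) (n p K ρ : R) :
  1 <= n -> 0 <= p -> 1 <= K -> K <= n -> 0 < ρ ->
  ln p <= ρ / 4 * (n / K ^+ 2) -> ln n <= ρ / 8 * (n / K ^+ 2) ->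
  p * p * K * (n * (6 * expR (- (ρ * (n / K ^+ 2))))) <= 36 / ((n + 1) * (n + 2)).
Proof.
move=> n1 p0 K1 Kn ρ0; set L := n / K ^+ 2 => hp hn.
have n0 : 0 < n by lra.
have pe : p <= expR (ρ / 4 * L).
  have [->|pp] := eqVneq p 0; first exact: expR_ge0.
  by rewrite -[p]lnK ?ler_expR// posrE lt_def pp.
have ne : n ^+ 4 <= expR (ρ / 2 * L).
  rewrite -[n in n ^+ 4](lnK (n0 : n \is Num.pos)) -expRM_natl ler_expR.
  lra.
have eE : expR (- (ρ * L)) = (expR (ρ / 4 * L) * expR (ρ / 4 * L) * expR (ρ / 2 * L))^-1.
  by rewrite -!expRD expRN; congr (expR _)^-1; field.
set a := expR (ρ / 4 * L) in pe eE *; set b := expR (ρ / 2 * L) in ne eE *.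
have a0 : 0 < a by exact: expR_gt0.
have b0 : 0 < b by exact: expR_gt0.
apply: (@le_trans _ _ (a * a * n * (n * (6 * expR (- (ρ * L)))))).
  by do 3?[apply: ler_pM => //]; rewrite ?mulr_ge0 ?expR_ge0//; lra.
rewrite eE.
have -> : a * a * n * (n * (6 * (a * a * b)^-1)) = 6 * n ^+ 2 / b.
  by field; rewrite !gt_eqF.
apply: (@le_trans _ _ (6 * n ^+ 2 / n ^+ 4)).
  apply: ler_wpM2l; first by rewrite mulr_ge0 ?sqr_ge0.
  by rewrite lef_pV2 ?posrE// exprn_gt0.
rewrite ler_pdivrMr ?exprn_gt0// mulrAC ler_pdivlMr; last by rewrite mulr_gt0//; lra.
have -> : 36 * n ^+ 4 = 6 * n ^+ 2 * (6 * n ^+ 2) by ring.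
by apply: ler_wpM2l; [rewrite mulr_ge0 ?sqr_ge0//|nra].
Qed.

(** * Asymptotic regime and conclusion *)

Theorem theorem2 (R : realType) (dT : measure_display) (T : measurableType dT)
  (P : probability T R) (p K : nat -> nat)
  (X : forall n : nat, nat -> 'I_(p n) -> T -> R)
  (Y : forall n : nat, nat -> T -> 'I_(K n))
  (S : forall n : nat, {set 'I_(p n) * 'I_(p n)})
  (c1 c2 c r d c3 : R) :
  (* sampling: for each n, (X_i, Y_i), i < n, are i.i.d. *)
  (forall n, sample_iid P n (X n) (Y n)) ->
  (* (C1) *)
  0 < c1 -> 0 < c2 ->
  (forall n, (2 <= n)%N -> forall k : 'I_(K n),
     c1 / (K n)%:R <= pi_pop P (Y n 0%N) k <= c2 / (K n)%:R) ->
  (* (C2) *)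
  0 < c -> 0 <= r < 1 / 2 ->
  (forall n, (2 <= n)%N ->
     ((2 * c * n%:R `^ (- r))%:E <
      min_on (w_pop P (X n 0%N) (X n 1%N) (Y n 0%N) (Y n 1%N)) (S n))%E) ->
  (* (C3) *)
  0 <= d < 1 / 2 - r ->
  (fun n : nat => ((K n)%:R : R)) =O_\oo (fun n : nat => (n%:R : R) `^ d) ->
  (* (C4) *)
  (fun n : nat => ln ((p n)%:R : R)) =o_\oo (fun n : nat => (n%:R : R) `^ (1 - 2 * (r + d))) ->
  (* (C5) *)
  0 < c3 ->
  (c3%:E <= limn_einf (fun n : nat =>
      gap (w_pop P (X n 0%N) (X n 1%N) (Y n 0%N) (Y n 1%N)) (S n)))%E ->
  (* K^2 log(n) / n = o(1) *)
  (fun n : nat => ((K n)%:R : R) ^+ 2 * ln (n%:R : R) / n%:R) @ \oo --> (0 : R) ->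
  {ae P, forall w : T,
     (0 < limn_einf (fun n : nat =>
        gap (w_hat n (fun i j => X n i j w) (fun i => Y n i w)) (S n)))%E}.
Proof.
move=> iid c10 c20 hπ _ /andP[r0 _] _ /andP[d0 _] /eqOE/eqO_exP[C C0 hK] /eqoE/eqoP hp c30 hgap hKn.
(* The population gap is eventually at least $c_3/2$, and a uniform error [ε] costs $2\varepsilon =
   c_3/4$. The second bound on [δ] makes [54 * δ * c2] at most [ε / 2]. *)
pose ε := c3 / 8; pose δ := Num.min (1 / 8) (ε / (108 * c2)).
have ε0 : 0 < ε by rewrite divr_gt0.
have δ0 : 0 < δ by rewrite lt_min divr_gt0//= divr_gt0// mulr_gt0.
have δ8 : δ <= 1 / 8 by rewrite ge_min lexx.
have δε : 54 * δ * c2 <= ε / 2.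
  have : δ <= ε / (108 * c2) by rewrite ge_min lexx orbT.
  by rewrite ler_pdivlMr ?mulr_gt0//; lra.
(* [ρ] is the coefficient of $n/K^2$ in the concentration exponent. *)
pose ρ := c1 ^+ 2 * δ ^+ 2 / 8.
have ρ0 : 0 < ρ by rewrite divr_gt0// mulr_gt0// exprn_gt0.
(* [η] will bound $K^2 \ln n / n$. Its three components yield, in order, $K \le n$, the bound on
   $\ln n$, and $7K^2/(n c_1) \le \varepsilon/2$. *)
pose η := Num.min (Num.min 1 (ρ / 8)) (ε * c1 / 14).
have η0 : 0 < η.
  have εc : 0 < ε * c1 / 14 by rewrite divr_gt0// mulr_gt0.
  by rewrite !lt_min ltr01 εc divr_gt0.
have η1 : η <= 1 by rewrite !ge_min lexx.
have ηρ : η <= ρ / 8 by rewrite !ge_min lexx orbT.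
have ηε : η <= ε * c1 / 14 by rewrite !ge_min lexx orbT.
have K1 n : 1 <= (K n)%:R :> R.
  by rewrite ler1n; case: (K n) (Y n) => // Yn; case: (Yn 0%N point).
have near_regime : \forall n \near \oo,
    [/\ (2 <= n)%N, (K n)%:R <= n%:R :> R, (K n)%:R ^+ 2 / n%:R <= η,
        ln (p n)%:R <= ρ / 4 * (n%:R / (K n)%:R ^+ 2) &
        ln n%:R <= ρ / 8 * (n%:R / (K n)%:R ^+ 2)].
  (* (C4) is used with constant $\rho/(4C^2)$: by (C3) and $r \ge 0$, $n^{1-2(r+d)} \le n^{1-2d} \le
     C^2 n/K^2$, so the factor $C^2$ cancels. *)
  have hp' := hp _ (divr_gt0 (divr_gt0 ρ0 (ltr0n _ 4)) (exprn_gt0 2 C0)).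
  have hη : \forall n \near \oo, `|0 - (K n)%:R ^+ 2 * ln n%:R / n%:R| <= η.
    by move/cvgrPdist_le : hKn; apply.
  near=> n.
  have n2 : (2 <= n)%N by near: n; exists 2%N.
  have n1 : 1 <= n%:R :> R by rewrite ler1n ltnW.
  have n0 : 0 < n%:R :> R by lra.
  (* Once $n \ge e$, a bound on $K^2 \ln n/n$ is also one on $K^2/n$. *)
  have lnn : 1 <= ln n%:R :> R.
    rewrite -[X in X <= _]expRK ler_ln ?posrE ?expR_gt0//.
    by near: n; exact: nbhs_infty_ger.
  have hKln : (K n)%:R ^+ 2 * ln n%:R / n%:R <= η.
    apply: le_trans (ler_norm _) _; rewrite -[X in `|X|]opprK normrN -[X in `|X|]add0r.
    by near: n.
  have K0 : 0 < (K n)%:R ^+ 2 :> R by rewrite exprn_gt0// (lt_le_trans _ (K1 n)).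
  have hK2 : (K n)%:R ^+ 2 / n%:R <= η.
    apply: le_trans hKln; rewrite ler_wpM2r ?invr_ge0 ?(ltW n0)//.
    by rewrite ler_peMr// ltW.
  split => //.
  - have : (K n)%:R ^+ 2 <= n%:R :> R.
      by move: hK2; rewrite ler_pdivrMr// => /le_trans; apply; rewrite ler_piMl// ltW.
    by apply: le_trans; rewrite expr2 ler_peMr// (le_trans _ (K1 n)).
  - have hKC : (K n)%:R <= C * n%:R `^ d.
      have : `|(K n)%:R : R| <= C * `|n%:R `^ d| by near: n.
      by rewrite ger0_norm// ger0_norm ?powR_ge0.
    have hpC : ln (p n)%:R <= ρ / 4 / C ^+ 2 * n%:R `^ (1 - 2 * (r + d)).
      have : `|ln (p n)%:R : R| <= ρ / 4 / C ^+ 2 * `|n%:R `^ (1 - 2 * (r + d))| by near: n.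
      rewrite (ger0_norm (powR_ge0 _ _)); exact: le_trans (ler_norm _).
    apply: (le_trans hpC).
    have h1 : n%:R `^ (1 - 2 * (r + d)) <= n%:R `^ (1 - 2 * d) :> R.
      by apply: ler_powR => //; lra.
    have h2 : n%:R `^ (1 - 2 * d) * (n%:R `^ d) ^+ 2 = n%:R :> R.
      rewrite -powR_mulrn ?powR_ge0// -powRrM -powRD ?(gt_eqF n0) ?implybT//.
      rewrite [X in _ `^ X](_ : _ = 1); last by ring.
      by rewrite powRr1.
    have h3 : n%:R `^ (1 - 2 * d) * (K n)%:R ^+ 2 <= C ^+ 2 * n%:R.
      apply: (@le_trans _ _ (n%:R `^ (1 - 2 * d) * (C * n%:R `^ d) ^+ 2)).
        apply: ler_wpM2l; first exact: powR_ge0.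
        by rewrite lerXn2r ?nnegrE// mulr_ge0 ?powR_ge0// ltW.
      by rewrite exprMn mulrCA h2.
    have h4 : n%:R `^ (1 - 2 * (r + d)) <= C ^+ 2 * (n%:R / (K n)%:R ^+ 2).
      rewrite mulrA ler_pdivlMr//; apply: le_trans h3.
      by apply: ler_wpM2r => //; exact: ltW.
    have CC : 0 < C ^+ 2 by exact: exprn_gt0.
    have ρC : 0 <= ρ / 4 / C ^+ 2 by apply/ltW/divr_gt0 => //; exact: divr_gt0.
    apply: (le_trans (ler_wpM2l ρC h4)).
    by rewrite mulrA divfK ?gt_eqF.
  - apply: (@le_trans _ _ (η * (n%:R / (K n)%:R ^+ 2))).
      by move: hKln; rewrite ler_pdivrMr// mulrA ler_pdivlMr//; lra.
    by rewrite ler_wpM2r// divr_ge0 ?(ltW n0)// ltW.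
have conc : \forall n \near \oo, fails_within P (36 / (n.+1%:R * n.+2%:R))
    (fun w => forall jl, `|w_hat n (fun i j => X n i j w) (fun i => Y n i w) jl -
        w_pop P (X n 0%N) (X n 1%N) (Y n 0%N) (Y n 1%N) jl| <= ε).
  apply: filterS near_regime => n [n2 Kn hK2 hpn hn].
  have n0 : 0 < n%:R :> R by rewrite ltr0n ltnW.
  have := @w_hat_concentration R _ _ P n (p n) (K n) (X n) (Y n) c1 c2 δ n2 (iid n) c10 (hπ n n2).
  rewrite δ8 (ltW δ0) => /(_ isT); apply: fails_within_sub => [|w Hw jl].
    have := @bad_event_bound R n%:R (p n)%:R (K n)%:R ρ.
    rewrite ler1n (ltnW n2) ler0n K1 Kn ρ0 => /(_ isT isT isT isT isT hpn hn).
    move=> hb; rewrite -[n.+2]addn2 -[n.+1]addn1 !natrM !natrD; apply: le_trans hb.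
    rewrite le_eqVlt; apply/orP; left; apply/eqP; congr (_ * (_ * (_ * expR (- _)))).
    by rewrite /ρ; field; rewrite gt_eqF// (lt_le_trans _ (K1 n)).
  apply: (le_trans (Hw jl)).
  have : 7 * (K n)%:R ^+ 2 / (n%:R * c1) <= ε / 2.
    have -> : 7 * (K n)%:R ^+ 2 / (n%:R * c1) = 7 / c1 * ((K n)%:R ^+ 2 / n%:R).
      by field; rewrite !gt_eqF.
    rewrite (le_trans (ler_wpM2l _ (le_trans hK2 ηε))) ?divr_ge0 ?(ltW c10)//.
    by rewrite le_eqVlt; apply/orP; left; apply/eqP; field; rewrite gt_eqF.
  lra.
have pop_gap : \forall n \near \oo, ((c3 / 2)%:E <=
    gap (w_pop P (X n 0%N) (X n 1%N) (Y n 0%N) (Y n 1%N)) (S n))%E.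
  by apply: lt_limn_einf_near; apply: lt_le_trans hgap; rewrite lte_fin; lra.
apply: filterS (ae_near_of_fails_within conc) => w Hw.
apply: (@lt_le_trans _ _ (c3 / 2 - 2 * ε)%:E); first by rewrite lte_fin /ε; lra.
apply: near_le_limn_einf; apply: filterS2 Hw pop_gap => n; exact: gap_perturb.
Unshelve. all: by end_near. Qed.
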